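(* Let $\gamma$ be a regular curve in $\mathbb{S}^2_+$. Then $\gamma$ is a spherical catenary (with parameter $\lambda\in\mathbb{R}$) if and only if its geodesic curvature $\kappa_s$ satisfies $$\kappa_s=\frac{\langle \mathbf{n},X\rangle}{d+\lambda},$$ where $\mathbf{n}$ is the unit normal vector of the curve $\gamma$ (as a tangent vector on $\mathbb{S}^2$ orthogonal to $\gamma'$), and $d$ is the distance to $P$.
   Context: $\mathbb{S}^2=\{(x,y,z)\in\mathbb{R}^3: x^2+y^2+z^2=1\}$, $\mathbb{S}^2_+=\{(x,y,z)\in\mathbb{S}^2: z>0\}$, $P=\{(x,y,z)\in\mathbb{S}^2:z=0\}$, and $\langle\cdot,\cdot\rangle$ is the Euclidean inner product. The parametrization is $\Psi(u,v)=(\cos u\cos v,\cos u\sin v,\sin u)$. For $p=\Psi(u,v)\in\mathbb{S}^2_+$ with $u\in(0,\pi/2]$, the distance in $\mathbb{S}^2$ to $P$ is $d=\arcsin z=u$. The vector field $X$ on $\mathbb{S}^2$ (defined except at the north and south poles) is the unit vector field tangent to the geodesics (meridians) orthogonal to $P$, namely the gradient of the distance function on $\mathbb{S}^2_+$: $X(\Psi(u,v))=\Psi_u(u,v)=(-\sin u\cos v,-\sin u\sin v,\cos u)$. Write $\gamma(t)=\Psi(u(t),v(t))$, $t\in[a,b]$. Regular means $\gamma'(t)\neq0$ for all $t$. The potential energy of $\gamma$ is $$\mathcal{E}_S[\gamma]=\int_a^b (d+\lambda)|\gamma'(t)|\,dt=\int_a^b(u+\lambda)\sqrt{u'^2+v'^2\cos^2u}\,dt,$$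 where $\lambda\in\mathbb{R}$ is a constant (a Lagrange multiplier). A spherical catenary is a critical point of $\mathcal{E}_S$ (for variations with fixed endpoints), i.e. $(u,v)$ satisfies both Euler–Lagrange equations of the Lagrangian $J=(u+\lambda)\sqrt{u'^2+v'^2\cos^2u}$. With the orientation $N(p)=-p$ of $\mathbb{S}^2$: $\mathbf{n}=\dfrac{\gamma\times\gamma'}{|\gamma'|}$ and $\kappa_s=\dfrac{\langle\gamma,\gamma'\times\gamma''\rangle}{|\gamma'|^3}$. *)

(* Defs.v *)
From Stdlib Require Import Reals Lra.
From Coquelicot Require Import Coquelicot.

Open Scope R_scope.

Definition vec3 : Type := (R * R * R)%type.

Definition cx (p : vec3) : R := fst (fst p).
Definition cy (p : vec3) : R := snd (fst p).
Definition cz (p : vec3) : R := snd p.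

Definition dot (p q : vec3) : R := cx p * cx q + cy p * cy q + cz p * cz q.

Definition cross (p q : vec3) : vec3 :=
  (cy p * cz q - cz p * cy q, cz p * cx q - cx p * cz q, cx p * cy q - cy p * cx q).

(* The Euclidean norm; Coquelicot's [norm] on a product is only equivalent to it. *)
Definition enorm (p : vec3) : R := sqrt (dot p p).

Definition scal3 (k : R) (p : vec3) : vec3 := (k * cx p, k * cy p, k * cz p).

Definition velocity (g : R -> vec3) (t : R) : vec3 :=
  (Derive (fun s => cx (g s)) t, Derive (fun s => cy (g s)) t, Derive (fun s => cz (g s)) t).

Definition acceleration (g : R -> vec3) : R -> vec3 := velocity (velocity g).

Definition Psi (u v : R) : vec3 := (cos u * cos v, cos u * sin v, sin u).

(* The value at [Psi u v] of the unit field tangent to the meridians. *)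
Definition Xfield (u v : R) : vec3 := (- sin u * cos v, - sin u * sin v, cos u).

(* Spherical distance from a point of the closed upper hemisphere to the equator [z = 0]. *)
Definition dist_equator (p : vec3) : R := asin (cz p).

Definition curve (u v : R -> R) (t : R) : vec3 := Psi (u t) (v t).

(* Orientation [N p = - p] of the sphere. *)
Definition unit_normal (g : R -> vec3) (t : R) : vec3 :=
  scal3 (/ enorm (velocity g t)) (cross (g t) (velocity g t)).

Definition geodesic_curvature (g : R -> vec3) (t : R) : R :=
  dot (g t) (cross (velocity g t) (acceleration g t)) / enorm (velocity g t) ^ 3.

(* Class C^2 on the whole line. A C^2 function on [a, b] extends to such a
   function, and its derivatives on [a, b] do not depend on the extension, so
   curves and variations over [a, b] are represented without loss this way. *)
Definition C2 (f : R -> R) : Prop :=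
  forall k : nat, (k <= 2)%nat ->
  forall t : R, ex_derive_n f k t /\ continuous (Derive_n f k) t.

Definition energy (lam a b : R) (g : R -> vec3) : R :=
  RInt (fun t => (dist_equator (g t) + lam) * enorm (velocity g t)) a b.

(* Critical point of the energy for fixed-endpoint variations: the first
   variation exists and vanishes in every direction [(phi, psi)]. *)
Definition spherical_catenary (lam a b : R) (u v : R -> R) : Prop :=
  forall phi psi : R -> R,
    C2 phi -> C2 psi ->
    phi a = 0 -> phi b = 0 -> psi a = 0 -> psi b = 0 ->
    is_derive
      (fun eps => energy lam a b
         (curve (fun t => u t + eps * phi t) (fun t => v t + eps * psi t)))
      0 0.

(* Main.v *)
Require Import Defs.
From Stdlib Require Import Reals Lra Lia Classical ClassicalEpsilon.
From Coquelicot Require Import Coquelicot.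

(** In the chart, with [S = |gamma'|], both Euler-Lagrange expressions are multiples of
    one scalar, the defect [D = S^3 (<n, X> - (u + lam) kappa)]: the first variation in
    the direction [(phi, psi)] is the integral of [cos u * D / S^3 * (v' phi - u' psi)].
    Since [cos u > 0] on [(a, b)] (the pole is a maximum of [u], where an interior
    [gamma'] would vanish), criticality means [D = 0].  Near a pole at an endpoint
    [pi/2 - u] vanishes to exactly first order and [phi] to at least first order, so
    small variations stay in the hemisphere and [asin (sin u) = u] persists.

    It remains to compare [D = 0] with the curvature equation where [u + lam = 0],
    the quotient there being [0].  If [D = 0], the momentum conjugate to [v]
    vanishes at such a point, hence everywhere, and [gamma] is an arc of a meridian, with
    [kappa = 0].  Conversely, if [D <> 0] at such a point then [u] is constant near it,
    but a parallel other than the equator has [kappa <> 0]. *)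

Open Scope R_scope.

(** * Continuity of composite real-valued expressions *)

Section Continuity.
Context {T : UniformSpace}.
Implicit Types (f g : T -> R) (x : T).

Lemma continuous_Rplus f g x :
  continuous f x -> continuous g x -> continuous (fun t => f t + g t) x.
Proof. apply (continuous_plus (V := R_NormedModule)). Qed.

Lemma continuous_Ropp f x : continuous f x -> continuous (fun t => - f t) x.
Proof. apply (continuous_opp (V := R_NormedModule)). Qed.

Lemma continuous_Rminus f g x :
  continuous f x -> continuous g x -> continuous (fun t => f t - g t) x.
Proof. apply (continuous_minus (V := R_NormedModule)). Qed.

Lemma continuous_Rmult f g x :
  continuous f x -> continuous g x -> continuous (fun t => f t * g t) x.
Proof. apply (continuous_mult (K := R_AbsRing)). Qed.

Lemma continuous_pow f (n : nat) x :
  continuous f x -> continuous (fun t => f t ^ n) x.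
Proof.
intros Hf; induction n as [|n IH]; simpl.
- apply continuous_const.
- now apply continuous_Rmult.
Qed.

Lemma continuous_Rcomp (h : R -> R) f x :
  continuous f x -> continuous h (f x) -> continuous (fun t => h (f t)) x.
Proof. apply (continuous_comp f h). Qed.

Lemma continuous_cos_comp f x : continuous f x -> continuous (fun t => cos (f t)) x.
Proof. intros Hf; apply (continuous_Rcomp cos f x Hf), continuous_cos. Qed.

Lemma continuous_sin_comp f x : continuous f x -> continuous (fun t => sin (f t)) x.
Proof. intros Hf; apply (continuous_Rcomp sin f x Hf), continuous_sin. Qed.

Lemma continuous_sqrt_comp f x : continuous f x -> continuous (fun t => sqrt (f t)) x.
Proof. intros Hf; apply (continuous_Rcomp sqrt f x Hf), continuous_sqrt. Qed.

Lemma continuous_Rdiv f g x :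
  continuous f x -> continuous g x -> g x <> 0 -> continuous (fun t => f t / g t) x.
Proof.
intros Hf Hg H0; apply continuous_Rmult; [exact Hf|].
now apply (continuous_Rcomp Rinv g x Hg), continuous_Rinv.
Qed.

Lemma continuous_pos_locally f x :
  continuous f x -> 0 < f x -> locally x (fun t => 0 < f t).
Proof. intros Hf H0; apply (Hf (fun y => 0 < y)), (open_gt 0), H0. Qed.

End Continuity.

Lemma continuous_snd_comp (f : R -> R) (x y : R) :
  continuous f y -> continuous (fun z : R * R => f (snd z)) (x, y).
Proof. intros Hf; apply (continuous_Rcomp f snd (x, y)); [apply continuous_snd | exact Hf]. Qed.

(** Recursion on the shape of the function: atoms are looked up in the context, and nonzero
    denominators are left as goals. *)
Ltac cont :=
  lazymatch goal with
  | |- continuous (fun z => @?f z + @?g z) _ => apply (continuous_Rplus f g); cont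
  | |- continuous (fun z => @?f z - @?g z) _ => apply (continuous_Rminus f g); cont
  | |- continuous (fun z => - @?f z) _ => apply (continuous_Ropp f); cont
  | |- continuous (fun z => @?f z * @?g z) _ => apply (continuous_Rmult f g); cont
  | |- continuous (fun z => @?f z / @?g z) _ => apply (continuous_Rdiv f g); cont
  | |- continuous (fun z => @?f z ^ ?n) _ => apply (continuous_pow f n); cont
  | |- continuous (fun z => cos (@?f z)) _ => apply (continuous_cos_comp f); cont
  | |- continuous (fun z => sin (@?f z)) _ => apply (continuous_sin_comp f); cont
  | |- continuous (fun z => sqrt (@?f z)) _ => apply (continuous_sqrt_comp f); cont
  | |- continuous (fun _ => ?c) _ => apply continuous_const
  | |- continuous (fun z => fst z) _ => apply continuous_fst
  | |- continuous (fun z => ?f (snd z)) _ => apply (continuous_snd_comp f); cont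
  | |- continuous (fun z => z) _ => apply continuous_id
  | |- continuous _ _ => try assumption
  | |- _ => idtac
  end.

(** * Local behaviour at points of a closed interval, and compactness *)

Lemma locally_R_ball (x : R) (P : R -> Prop) :
  locally x P -> exists d, 0 < d /\ forall t, Rabs (t - x) < d -> P t.
Proof. intros [d Hd]; exists d; split; [apply cond_pos | intros t Ht; now apply Hd]. Qed.

Lemma continuous_neq0_locally (f : R -> R) (x : R) :
  continuous f x -> f x <> 0 -> exists d, 0 < d /\ forall t, Rabs (t - x) < d -> f t <> 0.
Proof.
intros Hf H0.
destruct (locally_R_ball x (fun t => 0 < f t ^ 2)) as [d [Hd H]].
- apply continuous_pos_locally; [cont | now apply pow2_gt_0].
- exists d; split; [exact Hd|]; intros t Ht E; specialize (H t Ht); rewrite E in H; lra.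
Qed.

Lemma is_derive_increment (f : R -> R) (x l eps : R) :
  is_derive f x l -> 0 < eps ->
  exists d, 0 < d /\
    forall t, Rabs (t - x) < d -> Rabs (f t - f x - l * (t - x)) <= eps * Rabs (t - x).
Proof.
intros [_ Hf] He.
destruct (locally_R_ball _ _ (Hf x (fun P H => H) (mkposreal eps He))) as [d [Hd H]].
exists d; split; [exact Hd|]; intros t Ht.
specialize (H t Ht); unfold norm, minus, plus, opp, scal in H; simpl in H.
unfold mult, abs in H; simpl in H.
replace (f t - f x - l * (t - x)) with (f t + - f x + - ((t + - x) * l)) by ring.
exact H.
Qed.

(** With tolerance $|l|/2$ the linear term outweighs the remainder. *)
Lemma is_derive_isolated_zero (f : R -> R) (x l : R) :
  is_derive f x l -> l <> 0 ->
  exists d, 0 < d /\ forall t, 0 < Rabs (t - x) < d -> f t <> f x.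
Proof.
intros Hf Hl.
assert (Hl' : 0 < Rabs l) by now apply Rabs_pos_lt.
destruct (is_derive_increment f x l (Rabs l / 2) Hf) as [d [Hd H]]; [lra|].
exists d; split; [exact Hd|]; intros t [Ht0 Ht] E.
specialize (H t Ht); rewrite E in H.
replace (f x - f x - l * (t - x)) with (- (l * (t - x))) in H by ring.
rewrite Rabs_Ropp, Rabs_mult in H; nra.
Qed.

(** Supplies approach points inside the open interval even when [x] is an endpoint: to the right of
    [x], or to the left when [x = b]. *)
Lemma interval_near (a b x d : R) :
  a < b -> a <= x <= b -> 0 < d -> exists t, a < t < b /\ 0 < Rabs (t - x) < d.
Proof.
intros Hab Hx Hd.
destruct (Rlt_le_dec x b) as [H|H].
- exists (x + Rmin (d / 2) ((b - x) / 2)).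
  assert (0 < Rmin (d / 2) ((b - x) / 2)) by (apply Rmin_pos; lra).
  pose proof (Rmin_l (d / 2) ((b - x) / 2)); pose proof (Rmin_r (d / 2) ((b - x) / 2)).
  split; [lra|]; rewrite Rabs_pos_eq; lra.
- exists (x - Rmin (d / 2) ((b - a) / 2)).
  assert (0 < Rmin (d / 2) ((b - a) / 2)) by (apply Rmin_pos; lra).
  pose proof (Rmin_l (d / 2) ((b - a) / 2)); pose proof (Rmin_r (d / 2) ((b - a) / 2)).
  split; [lra|]; rewrite Rabs_left; lra.
Qed.

(** Carries identities to the endpoints and across isolated exceptional points. *)
Lemma continuous_zero_limit (a b x d : R) (f : R -> R) :
  a < b -> a <= x <= b -> 0 < d -> continuous f x ->
  (forall t, a < t < b -> 0 < Rabs (t - x) < d -> f t = 0) -> f x = 0.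
Proof.
intros Hab Hx Hd Hf H0.
destruct (Req_dec (f x) 0) as [E|E]; [exact E|exfalso].
destruct (continuous_neq0_locally f x Hf E) as [d' [Hd' H]].
destruct (interval_near a b x (Rmin d d') Hab Hx) as [t [Ht Htx]]; [now apply Rmin_pos|].
pose proof (Rmin_l d d'); pose proof (Rmin_r d d').
apply (H t); [lra|]; apply H0; lra.
Qed.

(** A nonzero derivative would isolate the value [c]; at an endpoint the values on one side suffice
    for this. *)
Lemma is_derive_constant_on (a b x l c : R) (f : R -> R) :
  a < b -> a <= x <= b -> is_derive f x l ->
  (forall t, a <= t <= b -> f t = c) -> l = 0.
Proof.
intros Hab Hx Hf H0.
destruct (Req_dec l 0) as [E|E]; [exact E|exfalso].
destruct (is_derive_isolated_zero f x l Hf E) as [d [Hd H]].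
destruct (interval_near a b x d Hab Hx Hd) as [t [Ht Htx]].
apply (H t Htx); rewrite !H0; lra.
Qed.

(** A tube lemma: by compactness of $[a,b]$ the local boxes can be given a common width in the first
    variable. *)
Lemma locally_2d_compact (a b x : R) (P : R -> R -> Prop) :
  (forall t, a <= t <= b -> locally_2d P x t) ->
  locally x (fun e => forall t, a <= t <= b -> P e t).
Proof.
intros H.
(* [compactness_value_1d] takes a gauge on all of $\mathbb{R}$; the radius $1$ outside $[a,b]$ is
   arbitrary. *)
assert (Hd : forall t, exists d : posreal, a <= t <= b ->
  forall e s, Rabs (e - x) < d -> Rabs (s - t) < d -> P e s).
{ intros t; destruct (classic (a <= t <= b)) as [Ht|Ht].
  - destruct (H t Ht) as [d Hd]; now exists d.
  - exists (mkposreal 1 Rlt_0_1); now intros. }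
set (delta := fun t => proj1_sig (constructive_indefinite_description _ (Hd t))).
destruct (compactness_value_1d a b delta) as [d Hcomp].
exists d; intros e He t Ht.
apply NNPP; intros HP; apply (Hcomp t Ht); intros [s [Hs [Hts Hds]]].
apply HP; revert Hs Hts Hds; unfold delta.
destruct (constructive_indefinite_description _ (Hd s)) as [r Hr]; simpl.
intros Hs Hts Hds; apply (Hr Hs); [|exact Hts].
apply Rlt_le_trans with d; [exact He | exact Hds].
Qed.

(** * $C^2$ functions, bumps and the fundamental lemma of the calculus of variations *)

Lemma C2_intro (f f1 f2 : R -> R) :
  (forall t, is_derive f t (f1 t)) -> (forall t, is_derive f1 t (f2 t)) ->
  (forall t, continuous f2 t) -> C2 f.
Proof.
intros H1 H2 Hc.
assert (E1 : forall t, Derive f t = f1 t) by (intros t; apply is_derive_unique, H1).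
assert (D2 : forall t, is_derive (Derive f) t (f2 t)).
{ intros t; apply is_derive_ext with f1; [intros s; now rewrite E1 | apply H2]. }
intros [|[|[|k]]] Hk t; try lia; (split; [exact I || idtac|]).
- apply (ex_derive_continuous f); eexists; apply H1.
- eexists; apply H1.
- apply (ex_derive_continuous (Derive f)); eexists; apply D2.
- eexists; apply D2.
- apply continuous_ext with f2; [|apply Hc].
  intros s; symmetry; apply is_derive_unique, D2.
Qed.

Lemma C2_elim (f : R -> R) :
  C2 f -> exists f1 f2 : R -> R,
    (forall t, is_derive f t (f1 t)) /\ (forall t, is_derive f1 t (f2 t)) /\
    (forall t, continuous f2 t).
Proof.
intros H; exists (Derive f), (Derive_n f 2); split; [|split]; intros t.
- apply Derive_correct, (H 1%nat); lia.
- apply (Derive_correct (Derive f)), (H 2%nat); lia.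
- apply (H 2%nat); lia.
Qed.

(** [auto_derive] produces the eta-expanded function, and rewriting needs this exact form. *)
Lemma Derive_eta (f : R -> R) (x l : R) :
  is_derive f x l -> Derive (fun y : R => f y) x = l.
Proof. apply is_derive_unique. Qed.

(** Only $0$ is delicate: the exponent is at least $2$, so for $h>0$ the difference quotient
    $h^{n+1}$ tends to $0$. *)
Lemma is_derive_pos_part_pow (n : nat) (x : R) :
  is_derive (fun y => Rmax 0 y ^ S (S n)) x (INR (S (S n)) * Rmax 0 x ^ S n).
Proof.
destruct (Rtotal_order x 0) as [H|[H|H]].
- apply is_derive_ext_loc with (fun _ => 0).
  + apply (filter_imp (fun y => y < 0)); [|now apply open_lt].
    intros y Hy; rewrite Rmax_left by lra; simpl; ring.
  + rewrite Rmax_left by lra.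
    replace (_ * _) with 0 by (simpl; ring); apply @is_derive_const.
- subst x; rewrite Rmax_left by lra.
  replace (_ * _) with 0 by (simpl; ring).
  apply is_derive_Reals; intros eps Heps.
  (* For $0<h<1$ one has $h^n\le 1$, so the quotient is at most $h<\varepsilon$. *)
  assert (Hm : 0 < Rmin 1 eps) by (apply Rmin_pos; lra).
  exists (mkposreal _ Hm); intros h Hh0 Hh; simpl in Hh.
  pose proof (Rmin_l 1 eps); pose proof (Rmin_r 1 eps).
  rewrite Rplus_0_l, (Rmax_left 0 0) by lra.
  replace (0 ^ S (S n)) with 0 by (simpl; ring).
  unfold Rminus; rewrite Ropp_0, !Rplus_0_r.
  destruct (Rle_dec h 0) as [Hneg|Hpos].
  + rewrite Rmax_left by lra.
    replace (0 ^ S (S n) / h) with 0 by (simpl; field; lra); now rewrite Rabs_R0.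
  + rewrite Rabs_pos_eq in Hh by lra.
    rewrite Rmax_right by lra.
    replace (h ^ S (S n) / h) with (h * h ^ n) by (simpl; field; lra).
    assert (0 <= h ^ n <= 1).
    { split; [apply pow_le; lra|]; rewrite <- (pow1 n); apply pow_incr; lra. }
    rewrite Rabs_pos_eq; nra.
- apply is_derive_ext_loc with (fun y => y ^ S (S n)).
  + apply (filter_imp (fun y => 0 < y)); [|now apply open_gt].
    intros y Hy; now rewrite Rmax_right by lra.
  + rewrite Rmax_right by lra.
    evar_last; [apply (is_derive_pow (fun y => y)), (is_derive_id (K := R_AbsRing))|].
    simpl pred; unfold one; simpl; ring.
Qed.

(** The cube of the positive part of $(t-p)(q-t)$; the third power is the least integer one that is
    $C^2$ at [p] and [q]. *)
Lemma C2_bump (p q : R) :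
  p < q -> exists f, C2 f /\ (forall t, p < t < q -> 0 < f t) /\
    (forall t, t <= p \/ q <= t -> f t = 0).
Proof.
intros Hpq.
set (m := Rmax 0); set (w := fun t => (t - p) * (q - t)).
assert (Hw : forall t, is_derive w t (p + q - 2 * t)).
{ intros t; unfold w; auto_derive; [exact I | ring]. }
assert (Hm3 : forall x, is_derive (fun y => m y ^ 3) x (3 * m x ^ 2)).
{ intros x; pose proof (is_derive_pos_part_pow 1 x) as H; simpl INR in H.
  now replace (1 + 1 + 1) with 3 in H by ring. }
assert (Hm2 : forall x, is_derive (fun y => m y ^ 2) x (2 * m x ^ 1)).
{ intros x; pose proof (is_derive_pos_part_pow 0 x) as H; simpl INR in H.
  now replace (1 + 1) with 2 in H by ring. }
exists (fun t => m (w t) ^ 3); split; [|split].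
- apply (C2_intro _ (fun t => 3 * m (w t) ^ 2 * (p + q - 2 * t))
    (fun t => 6 * m (w t) * (p + q - 2 * t) ^ 2 - 6 * m (w t) ^ 2)).
  + intros t; evar_last.
    * apply (is_derive_comp (fun y => m y ^ 3) w); [apply Hm3 | apply Hw].
    * unfold scal; simpl; unfold mult; simpl; ring.
  + intros t.
    assert (H : is_derive (fun s => m (w s) ^ 2) t
      ((p + q - 2 * t) * (2 * m (w t) ^ 1))).
    { apply (is_derive_comp (fun y => m y ^ 2) w); [apply Hm2 | apply Hw]. }
    (* Naming the square keeps [auto_derive] from looking inside it. *)
    set (g := fun s => m (w s) ^ 2) in *.
    change (is_derive (fun s => 3 * g s * (p + q - 2 * s)) t
      (6 * m (w t) * (p + q - 2 * t) ^ 2 - 6 * m (w t) ^ 2)).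
    auto_derive; [eexists; apply H|].
    rewrite (Derive_eta g _ _ H); unfold g; ring.
  + intros t.
    assert (continuous (fun s => m (w s)) t).
    { apply continuous_comp; [apply (ex_derive_continuous w); eexists; apply Hw|].
      (* $\max(0,y)=(y+|y|)/2$. *)
      apply (continuous_ext (fun y => (y + Rabs y) / 2)).
      - intros y; unfold m, Rmax, Rabs; destruct (Rle_dec 0 y), (Rcase_abs y); lra.
      - assert (continuous Rabs (w t)) by apply continuous_Rabs.
        cont; lra. }
    cont.
- intros t Ht; apply pow_lt; unfold m, w; rewrite Rmax_right; nra.
- intros t Ht; unfold m, w; rewrite Rmax_left; [ring | nra].
Qed.

(** A bump supported where $f>0$ would give a positive integral. *)
Lemma fundamental_lemma_nonpos (a b : R) (f : R -> R) :
  (forall t, a <= t <= b -> continuous f t) ->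
  (forall phi, C2 phi -> phi a = 0 -> phi b = 0 -> RInt (fun t => f t * phi t) a b = 0) ->
  forall t, a < t < b -> f t <= 0.
Proof.
intros Hf H t0 Ht0.
destruct (Rle_dec (f t0) 0) as [E|E]; [exact E|exfalso].
destruct (locally_R_ball t0 (fun t => 0 < f t)) as [d [Hd Hpos]].
{ apply continuous_pos_locally; [apply Hf|]; lra. }
set (r := Rmin d (Rmin (t0 - a) (b - t0))).
assert (Hr : 0 < r) by (repeat apply Rmin_pos; lra).
assert (r <= d /\ r <= t0 - a /\ r <= b - t0) as [Hrd [Hra Hrb]].
{ pose proof (Rmin_l (t0 - a) (b - t0)); pose proof (Rmin_r (t0 - a) (b - t0)).
  pose proof (Rmin_l d (Rmin (t0 - a) (b - t0))).
  pose proof (Rmin_r d (Rmin (t0 - a) (b - t0))); unfold r; lra. }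
destruct (C2_bump (t0 - r) (t0 + r)) as [phi [HC [Hin Hout]]]; [lra|].
assert (Hc : forall t, a <= t <= b -> continuous (fun s => f s * phi s) t).
{ intros t Ht; apply continuous_Rmult; [now apply Hf|].
  apply (HC 0%nat); lia. }
assert (Hex : forall c d, a <= c -> c <= d -> d <= b -> ex_RInt (fun s => f s * phi s) c d).
{ intros c e H1 H2 H3; apply (ex_RInt_continuous (V := R_CompleteNormedModule)).
  rewrite Rmin_left, Rmax_right by lra; intros; apply Hc; lra. }
assert (Hzero : forall c d, c <= d -> (forall t, c < t < d -> phi t = 0) ->
  RInt (fun s => f s * phi s) c d = 0).
{ intros c e Hce Hz; rewrite (RInt_ext _ (fun _ => 0)).
  - rewrite RInt_const; apply (Rmult_0_r (e - c)).
  - rewrite Rmin_left, Rmax_right by lra; intros t Ht; rewrite Hz by lra; apply Rmult_0_r. }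
assert (H0 : RInt (fun s => f s * phi s) a b = 0).
{ apply H; [exact HC | apply Hout; lra | apply Hout; lra]. }
rewrite <- (RInt_Chasles _ a (t0 - r) b) in H0 by (apply Hex; lra).
rewrite <- (RInt_Chasles _ (t0 - r) (t0 + r) b) in H0 by (apply Hex; lra).
rewrite (Hzero a), (Hzero (t0 + r)) in H0; try lra;
  try (intros; apply Hout; lra).
assert (0 < RInt (fun s => f s * phi s) (t0 - r) (t0 + r)).
{ apply RInt_gt_0; [lra | |intros; apply Hc; lra].
  intros t Ht; apply Rmult_lt_0_compat; [apply Hpos, Rabs_def1 | apply Hin]; lra. }
unfold plus in H0; simpl in H0; lra.
Qed.

Lemma fundamental_lemma (a b : R) (f : R -> R) :
  (forall t, a <= t <= b -> continuous f t) ->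
  (forall phi, C2 phi -> phi a = 0 -> phi b = 0 -> RInt (fun t => f t * phi t) a b = 0) ->
  forall t, a < t < b -> f t = 0.
Proof.
intros Hf H t Ht; apply Rle_antisym.
- now apply (fundamental_lemma_nonpos a b).
- enough (- f t <= 0) by lra.
  apply (fundamental_lemma_nonpos a b (fun s => - f s)); [| |exact Ht].
  + intros s Hs; apply continuous_Ropp; now apply Hf.
  + intros phi HC Ha Hb.
    assert (Hex : ex_RInt (fun s => f s * phi s) a b).
    { apply (ex_RInt_continuous (V := R_CompleteNormedModule)).
      rewrite Rmin_left, Rmax_right by lra; intros s Hs.
      apply continuous_Rmult; [now apply Hf | apply (HC 0%nat); lia]. }
    transitivity (opp (RInt (fun s => f s * phi s) a b)).
    * rewrite <- (RInt_opp (V := R_CompleteNormedModule)) by exact Hex.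
      apply RInt_ext; intros s _; symmetry; apply Ropp_mult_distr_l.
    * rewrite H by assumption; apply Ropp_0.
Qed.

(** * Speed, normal component and geodesic curvature in the chart *)

Definition speed2 (x p q : R) : R := p ^ 2 + (q * cos x) ^ 2.

(* [|gamma'|^3 * kappa_s] for latitude [x], [(p, q) = (u', v')], [(r, s) = (u'', v'')]. *)
Definition curvature_num (x p q r s : R) : R :=
  q * cos x * r + q ^ 3 * sin x * cos x ^ 2 - p * s * cos x + 2 * p ^ 2 * q * sin x.

(* With [S^2 = speed2], the Euler-Lagrange expressions [d/dt L_u' - L_u] and
   [d/dt L_v' - L_v] are [- q cos x / S^3] and [p cos x / S^3] times this. *)
Definition catenary_defect (lam x p q r s : R) : R :=
  q * cos x * speed2 x p q - (x + lam) * curvature_num x p q r s.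

Lemma velocity_curve (u v : R -> R) (t p q : R) :
  is_derive u t p -> is_derive v t q ->
  velocity (curve u v) t =
    (- sin (u t) * p * cos (v t) - cos (u t) * sin (v t) * q,
     - sin (u t) * p * sin (v t) + cos (u t) * cos (v t) * q,
     cos (u t) * p).
Proof.
intros Hu Hv; unfold velocity, curve, Psi, cx, cy, cz; simpl.
assert (ex_derive u t) by now exists p.
assert (ex_derive v t) by now exists q.
f_equal; [f_equal|]; apply is_derive_unique; auto_derive; auto;
  rewrite ?(Derive_eta u t p Hu), ?(Derive_eta v t q Hv); ring.
Qed.

Lemma enorm_velocity_curve (u v : R -> R) (t p q : R) :
  is_derive u t p -> is_derive v t q ->
  enorm (velocity (curve u v) t) = sqrt (speed2 (u t) p q).
Proof.
intros Hu Hv; rewrite (velocity_curve u v t p q Hu Hv).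
unfold enorm, dot, cx, cy, cz, speed2; simpl; f_equal.
(* [ring] computes modulo $\sin^2=1-\cos^2$ at $u$ and at $v$. *)
pose proof (sin2 (u t)) as E1; pose proof (sin2 (v t)) as E2; unfold Rsqr in E1, E2.
ring [E1 E2].
Qed.

Lemma dot_unit_normal_Xfield (u v : R -> R) (t p q : R) :
  is_derive u t p -> is_derive v t q ->
  dot (unit_normal (curve u v) t) (Xfield (u t) (v t)) =
    q * cos (u t) / sqrt (speed2 (u t) p q).
Proof.
intros Hu Hv; unfold unit_normal.
rewrite (enorm_velocity_curve u v t p q Hu Hv), (velocity_curve u v t p q Hu Hv).
unfold Rdiv; generalize (/ sqrt (speed2 (u t) p q)); intros k.
unfold dot, scal3, cross, Xfield, curve, Psi, cx, cy, cz; simpl.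
pose proof (sin2 (u t)) as E1; pose proof (sin2 (v t)) as E2; unfold Rsqr in E1, E2.
ring [E1 E2].
Qed.

Lemma geodesic_curvature_curve (u v u1 v1 u2 v2 : R -> R) :
  (forall t, is_derive u t (u1 t)) -> (forall t, is_derive u1 t (u2 t)) ->
  (forall t, is_derive v t (v1 t)) -> (forall t, is_derive v1 t (v2 t)) ->
  forall t, geodesic_curvature (curve u v) t =
    curvature_num (u t) (u1 t) (v1 t) (u2 t) (v2 t) / sqrt (speed2 (u t) (u1 t) (v1 t)) ^ 3.
Proof.
intros Hu Hu1 Hv Hv1 t; unfold geodesic_curvature.
rewrite (enorm_velocity_curve u v t (u1 t) (v1 t)) by auto; f_equal.
pose proof (fun s => velocity_curve u v s _ _ (Hu s) (Hv s)) as HV.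
assert (HA : acceleration (curve u v) t =
  (- cos (u t) * u1 t ^ 2 * cos (v t) - sin (u t) * u2 t * cos (v t)
     + 2 * sin (u t) * u1 t * sin (v t) * v1 t
     - cos (u t) * cos (v t) * v1 t ^ 2 - cos (u t) * sin (v t) * v2 t,
   - cos (u t) * u1 t ^ 2 * sin (v t) - sin (u t) * u2 t * sin (v t)
     - 2 * sin (u t) * u1 t * cos (v t) * v1 t
     - cos (u t) * sin (v t) * v1 t ^ 2 + cos (u t) * cos (v t) * v2 t,
   - sin (u t) * u1 t ^ 2 + cos (u t) * u2 t)).
(* Only the outer [velocity] is unfolded; the inner one is rewritten at every $s$ before
   differentiating again. *)
{ unfold acceleration, velocity at 1.
  assert (ex_derive u t) by now exists (u1 t).
  assert (ex_derive v t) by now exists (v1 t).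
  assert (ex_derive u1 t) by now exists (u2 t).
  assert (ex_derive v1 t) by now exists (v2 t).
  f_equal; [f_equal|];
    (erewrite Derive_ext by (intros s; rewrite HV; unfold cx, cy, cz; simpl; reflexivity));
    apply is_derive_unique; auto_derive; auto 20;
    rewrite ?(Derive_eta u t _ (Hu t)), ?(Derive_eta v t _ (Hv t)),
      ?(Derive_eta u1 t _ (Hu1 t)), ?(Derive_eta v1 t _ (Hv1 t)); ring. }
rewrite HA, HV; unfold dot, cross, curve, Psi, cx, cy, cz, curvature_num; simpl.
pose proof (sin2 (u t)) as E1; pose proof (sin2 (v t)) as E2; unfold Rsqr in E1, E2.
ring [E1 E2].
Qed.

Lemma speed2_pos (u v : R -> R) (t p q : R) :
  is_derive u t p -> is_derive v t q ->
  velocity (curve u v) t <> (0, 0, 0) -> 0 < speed2 (u t) p q.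
Proof.
intros Hu Hv H; rewrite (velocity_curve u v t p q Hu Hv) in H.
unfold speed2; destruct (Req_dec p 0) as [Hp|Hp].
- destruct (Req_dec (q * cos (u t)) 0) as [Hq|Hq].
  + exfalso; apply H; rewrite Hp; apply (f_equal2 pair); [apply (f_equal2 pair)|]; ring [Hq].
  + pose proof (pow2_gt_0 _ Hq); pose proof (pow2_ge_0 p); lra.
- pose proof (pow2_gt_0 _ Hp); pose proof (pow2_ge_0 (q * cos (u t))); lra.
Qed.

(** * The Lagrangian and its first variation *)

Definition lagrangian (lam x p q : R) : R := (x + lam) * sqrt (speed2 x p q).

(** The differential at $(x,p,q)$ in the direction $(dx,dp,dq)$; the factor beside $x+\lambda$ in
    the numerator is half the differential of [speed2]. *)
Definition lagrangian_diff (lam x p q dx dp dq : R) : R :=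
  dx * sqrt (speed2 x p q)
  + (x + lam) * (p * dp + q * cos x * (dq * cos x - q * sin x * dx)) / sqrt (speed2 x p q).

Lemma is_derive_lagrangian (lam x p q dx dp dq e : R) :
  0 < speed2 (x + e * dx) (p + e * dp) (q + e * dq) ->
  is_derive (fun e => lagrangian lam (x + e * dx) (p + e * dp) (q + e * dq)) e
    (lagrangian_diff lam (x + e * dx) (p + e * dp) (q + e * dq) dx dp dq).
Proof.
unfold lagrangian, lagrangian_diff, speed2; intros H.
pose proof (sqrt_lt_R0 _ H).
auto_derive; [exact H|].
simpl pow in *; field; lra.
Qed.

Lemma continuity_2d_pt_continuous (F : R -> R -> R) (x y : R) :
  continuous (fun z : R * R => F (fst z) (snd z)) (x, y) -> continuity_2d_pt F x y.
Proof. apply continuity_2d_pt_filterlim. Qed.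

Section FirstVariation.
Variables (lam a b : R) (u v u1 v1 phi psi phi1 psi1 : R -> R).
Hypothesis hab : a < b.
Hypotheses (cu : forall t, continuous u t) (cu1 : forall t, continuous u1 t)
  (cv1 : forall t, continuous v1 t) (cphi : forall t, continuous phi t)
  (cphi1 : forall t, continuous phi1 t) (cpsi1 : forall t, continuous psi1 t).
Hypothesis regular : forall t, a <= t <= b -> 0 < speed2 (u t) (u1 t) (v1 t).

Let Q (e t : R) := speed2 (u t + e * phi t) (u1 t + e * phi1 t) (v1 t + e * psi1 t).

Lemma continuous_varied_speed2 (e t : R) :
  continuous (fun z : R * R => Q (fst z) (snd z)) (e, t).
Proof.
pose proof (cu t); pose proof (cu1 t); pose proof (cv1 t).
pose proof (cphi t); pose proof (cphi1 t); pose proof (cpsi1 t).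
unfold Q, speed2; cont.
Qed.

Lemma varied_speed2_pos_2d (t : R) :
  a <= t <= b -> locally_2d (fun e s => 0 < Q e s) 0 t.
Proof.
intros Ht; apply locally_2d_locally.
apply (continuous_pos_locally (fun z : R * R => Q (fst z) (snd z))).
- apply continuous_varied_speed2.
- unfold Q; simpl; rewrite !Rmult_0_l, !Rplus_0_r; now apply regular.
Qed.

(** Differentiation under the integral sign: compactness gives one range of $\varepsilon$ on which
    the varied speed is positive throughout $[a,b]$, so the square root is smooth. *)
Lemma is_derive_RInt_lagrangian :
  is_derive
    (fun e => RInt (fun t =>
       lagrangian lam (u t + e * phi t) (u1 t + e * phi1 t) (v1 t + e * psi1 t)) a b)
    0
    (RInt (fun t => lagrangian_diff lam (u t) (u1 t) (v1 t) (phi t) (phi1 t) (psi1 t)) a b).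
Proof.
pose proof (locally_2d_compact a b 0 _ varied_speed2_pos_2d) as Hloc.
evar_last.
- apply (is_derive_RInt_param
    (fun e t => lagrangian lam (u t + e * phi t) (u1 t + e * phi1 t) (v1 t + e * psi1 t))).
  + rewrite Rmin_left, Rmax_right by lra.
    revert Hloc; apply filter_imp; intros e He t Ht.
    eexists; now apply is_derive_lagrangian, He.
  + rewrite Rmin_left, Rmax_right by lra; intros t Ht.
    (* Near $(0,t)$ the derivative in $\varepsilon$ is the explicit differential, whose joint
       continuity is visible. *)
    apply continuity_2d_pt_ext_loc with (fun e t =>
      lagrangian_diff lam (u t + e * phi t) (u1 t + e * phi1 t) (v1 t + e * psi1 t)
        (phi t) (phi1 t) (psi1 t)).
    * destruct (varied_speed2_pos_2d t Ht) as [d Hd]; exists d; intros e s He Hs.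
      symmetry; now apply is_derive_unique, is_derive_lagrangian, Hd.
    * apply continuity_2d_pt_continuous.
      assert (0 < sqrt (Q 0 t)).
      { now apply sqrt_lt_R0, (locally_2d_singleton _ _ _ (varied_speed2_pos_2d t Ht)). }
      pose proof (continuous_varied_speed2 0 t).
      pose proof (cu t); pose proof (cu1 t); pose proof (cv1 t).
      pose proof (cphi t); pose proof (cphi1 t); pose proof (cpsi1 t).
      unfold lagrangian_diff; cont; now apply Rgt_not_eq.
  + revert Hloc; apply filter_imp; intros e He.
    apply (ex_RInt_continuous (V := R_CompleteNormedModule)).
    rewrite Rmin_left, Rmax_right by lra; intros t Ht.
    pose proof (cu t); pose proof (cu1 t); pose proof (cv1 t).
    pose proof (cphi t); pose proof (cphi1 t); pose proof (cpsi1 t).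
    unfold lagrangian, speed2; cont.
- apply RInt_ext; rewrite Rmin_left, Rmax_right by lra; intros t Ht.
  apply is_derive_unique; evar_last.
  + apply is_derive_lagrangian.
    apply (locally_2d_singleton _ _ _ (varied_speed2_pos_2d t (conj (Rlt_le _ _ (proj1 Ht)) (Rlt_le _ _ (proj2 Ht))))).
  + now rewrite !Rmult_0_l, !Rplus_0_r.
Qed.

End FirstVariation.

(* Integration by parts of the first variation: the boundary term is [L_u' phi + L_v' psi]. *)
Lemma is_derive_boundary_term (lam t : R) (u u1 u2 v1 v2 phi phi1 psi psi1 : R -> R) :
  is_derive u t (u1 t) -> is_derive u1 t (u2 t) -> is_derive v1 t (v2 t) ->
  is_derive phi t (phi1 t) -> is_derive psi t (psi1 t) ->
  0 < speed2 (u t) (u1 t) (v1 t) ->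
  is_derive
    (fun s => (u s + lam) * (u1 s * phi s + v1 s * cos (u s) ^ 2 * psi s)
       / sqrt (speed2 (u s) (u1 s) (v1 s))) t
    (lagrangian_diff lam (u t) (u1 t) (v1 t) (phi t) (phi1 t) (psi1 t)
     - cos (u t) * catenary_defect lam (u t) (u1 t) (v1 t) (u2 t) (v2 t)
         / sqrt (speed2 (u t) (u1 t) (v1 t)) ^ 3 * (v1 t * phi t - u1 t * psi t)).
Proof.
intros Hu Hu1 Hv1 Hphi Hpsi HQ.
pose proof (sqrt_lt_R0 _ HQ) as HS.
pose proof (sqrt_sqrt _ (Rlt_le _ _ HQ)) as HSS.
assert (ex_derive u t) by now exists (u1 t).
assert (ex_derive u1 t) by now exists (u2 t).
assert (ex_derive v1 t) by now exists (v2 t).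
assert (ex_derive phi t) by now exists (phi1 t).
assert (ex_derive psi t) by now exists (psi1 t).
unfold lagrangian_diff, catenary_defect, curvature_num.
set (S := sqrt (speed2 (u t) (u1 t) (v1 t))) in *.
evar_last.
- unfold speed2; auto_derive; [|reflexivity].
  repeat (apply conj); auto; apply Rgt_not_eq, HS.
- rewrite (Derive_eta u t _ Hu), (Derive_eta u1 t _ Hu1), (Derive_eta v1 t _ Hv1),
    (Derive_eta phi t _ Hphi), (Derive_eta psi t _ Hpsi).
  change (sqrt (u1 t * (u1 t * 1) + v1 t * cos (u t) * (v1 t * cos (u t) * 1))) with S.
  (* Once [speed2] is replaced by $S^2$, $\sin u$ and $\cos u$ act as free variables, and the
     identity is polynomial modulo $S^2=u'^2+v'^2\cos^2u$. *)
  rewrite <- HSS; unfold speed2 in HSS; clearbody S.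
  generalize dependent (cos (u t)); generalize dependent (sin (u t)); intros s c HSS.
  field_simplify_eq; [|lra].
  ring_simplify in HSS.
  ring [HSS].
Qed.

Lemma RInt_ext_all (f g : R -> R) (a b : R) :
  (forall t, f t = g t) -> RInt f a b = RInt g a b.
Proof. intros H; apply RInt_ext; intros t _; apply H. Qed.

(** * Contact with the pole and the energy of nearby curves *)

(** At the pole the speed reduces to $|u'|$, while an interior maximum of $u$ would force $u'=0$. *)
Lemma pole_transversal (a b t : R) (u u1 : R -> R) (q : R) :
  (forall s, a <= s <= b -> u s <= PI / 2) ->
  a <= t <= b -> is_derive u t (u1 t) -> 0 < speed2 (u t) (u1 t) q -> u t = PI / 2 ->
  u1 t <> 0 /\ (t = a \/ t = b).
Proof.
intros Hle Ht Hu HQ E.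
assert (Hp : u1 t <> 0).
{ intros E1; unfold speed2 in HQ; rewrite E, E1, cos_PI2 in HQ; lra. }
split; [exact Hp|].
apply NNPP; intros Hab; apply Hp.
apply is_derive_Reals in Hu.
rewrite <- (derive_pt_eq_0 u t (u1 t) (exist _ (u1 t) Hu) Hu).
apply (deriv_maximum u a b); try lra.
intros s Hs1 Hs2; rewrite E; apply Hle; lra.
Qed.

(** Makes [asin] invert [sin] on the varied latitude. Away from the pole strict bounds persist by
    continuity; at the pole first-order rates are compared. *)
Lemma varied_latitude_range (a b : R) (u u1 phi phi1 : R -> R) :
  (forall t, a <= t <= b -> 0 < u t <= PI / 2) ->
  (forall t, is_derive u t (u1 t)) -> (forall t, is_derive phi t (phi1 t)) ->
  (forall t, a <= t <= b -> u t = PI / 2 -> u1 t <> 0 /\ phi t = 0) ->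
  locally 0 (fun e => forall t, a <= t <= b -> - (PI / 2) <= u t + e * phi t <= PI / 2).
Proof.
intros Hrange Hu Hphi Hpole.
assert (H2d : forall c t s, continuous
  (fun z : R * R => c * (u (snd z) + fst z * phi (snd z))) (t, s)).
{ intros c t s.
  assert (continuous u s) by (apply (ex_derive_continuous u); eexists; apply Hu).
  assert (continuous phi s) by (apply (ex_derive_continuous phi); eexists; apply Hphi).
  cont. }
(* The compactness lemma asks for a full neighbourhood of each $(0,t)$; at an endpoint the bound on
   $u$ is known only inside $[a,b]$, hence the repeated hypothesis. *)
enough (H : locally 0 (fun e => forall t, a <= t <= b ->
  a <= t <= b -> - (PI / 2) <= u t + e * phi t <= PI / 2)).
{ revert H; apply filter_imp; intros e H t Ht; now apply H. }
apply locally_2d_compact; intros t Ht.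
apply locally_2d_impl with (fun e s => - (PI / 2) <= u s + e * phi s); cycle 1.
{ apply locally_2d_locally.
  apply (filter_imp (fun z : R * R => 0 < PI / 2 + 1 * (u (snd z) + fst z * phi (snd z)))).
  { intros [e s]; simpl; lra. }
  apply (continuous_pos_locally
    (fun z : R * R => PI / 2 + 1 * (u (snd z) + fst z * phi (snd z)))).
  - apply continuous_Rplus; [apply continuous_const | apply H2d].
  - simpl; specialize (Hrange t Ht); pose proof PI_RGT_0; lra. }
enough (H : locally_2d (fun e s => a <= s <= b -> u s + e * phi s <= PI / 2) 0 t).
{ destruct H as [d Hd]; exists d; intros e s He Hs H1 H2; split; [exact H1|].
  now apply Hd. }
destruct (Rle_lt_or_eq_dec _ _ (proj2 (Hrange t Ht))) as [Hlt|Heq].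
- apply locally_2d_locally.
  apply (filter_imp (fun z : R * R => 0 < PI / 2 + (-1) * (u (snd z) + fst z * phi (snd z)))).
  { intros [e s]; simpl; lra. }
  apply (continuous_pos_locally
    (fun z : R * R => PI / 2 + (-1) * (u (snd z) + fst z * phi (snd z)))).
  + apply continuous_Rplus; [apply continuous_const | apply H2d].
  + simpl; lra.
- (* [PI / 2 - u] vanishes at [t] exactly to first order, and [phi] at least so. *)
  destruct (Hpole t Ht Heq) as [Hu1 Hphi0].
  assert (Hk : 0 < Rabs (u1 t)) by now apply Rabs_pos_lt.
  pose proof (Rabs_pos (phi1 t)) as Hm.
  destruct (is_derive_increment u t _ (Rabs (u1 t) / 2) (Hu t)) as [d1 [Hd1 H1]]; [lra|].
  destruct (is_derive_increment phi t _ 1 (Hphi t)) as [d2 [Hd2 H2]]; [lra|].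
  (* Chosen so that $|\varepsilon|<r$ gives
     $|\varepsilon\varphi(s)|\le\frac12|u'(t)||s-t|\le\pi/2-u(s)$. *)
  set (r := Rabs (u1 t) / 2 / (Rabs (phi1 t) + 1)).
  assert (Hr : 0 < r) by (apply Rdiv_lt_0_compat; lra).
  assert (Hrm : r * (Rabs (phi1 t) + 1) = Rabs (u1 t) / 2) by (unfold r; field; lra).
  assert (Hd : 0 < Rmin r (Rmin d1 d2)) by (repeat apply Rmin_pos; assumption).
  pose proof (Rmin_l r (Rmin d1 d2)); pose proof (Rmin_r r (Rmin d1 d2)).
  pose proof (Rmin_l d1 d2); pose proof (Rmin_r d1 d2).
  exists (mkposreal _ Hd); simpl; intros e s He Hs Hsab.
  specialize (H1 s ltac:(lra)); specialize (H2 s ltac:(lra)).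
  specialize (Hrange s Hsab).
  rewrite Heq in H1; rewrite Hphi0 in H2.
  rewrite Rminus_0_r in He.
  assert (Hphis : Rabs (phi s) <= (Rabs (phi1 t) + 1) * Rabs (s - t)).
  { replace (phi s) with ((phi s - 0 - phi1 t * (s - t)) + phi1 t * (s - t)) by ring.
    eapply Rle_trans; [apply Rabs_triang|]; rewrite Rabs_mult; lra. }
  assert (Hus : Rabs (u1 t) / 2 * Rabs (s - t) <= PI / 2 - u s).
  { assert (Rabs (u1 t) * Rabs (s - t) <=
      Rabs (u s - PI / 2 - u1 t * (s - t)) + Rabs (PI / 2 - u s)).
    { rewrite <- Rabs_mult, <- (Rabs_Ropp (u1 t * (s - t))).
      replace (- (u1 t * (s - t))) with
        ((u s - PI / 2 - u1 t * (s - t)) + (PI / 2 - u s)) by ring.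
      apply Rabs_triang. }
    rewrite (Rabs_pos_eq (PI / 2 - u s)) in * by lra; lra. }
  assert (e * phi s <= Rabs (u1 t) / 2 * Rabs (s - t)); [|lra].
  eapply Rle_trans; [apply Rle_abs|]; rewrite Rabs_mult, <- Hrm, Rmult_assoc.
  apply Rmult_le_compat; try apply Rabs_pos; lra.
Qed.

(** Restricted to small $\varepsilon$, since a latitude beyond $\pi/2$ would be folded back by
    [asin]. *)
Lemma energy_varied (lam a b : R) (u v u1 v1 phi psi phi1 psi1 : R -> R) :
  a < b ->
  (forall t, is_derive u t (u1 t)) -> (forall t, is_derive v t (v1 t)) ->
  (forall t, is_derive phi t (phi1 t)) -> (forall t, is_derive psi t (psi1 t)) ->
  (forall t, a <= t <= b -> 0 < u t <= PI / 2) ->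
  (forall t, a <= t <= b -> u t = PI / 2 -> u1 t <> 0 /\ phi t = 0) ->
  locally 0 (fun e =>
    RInt (fun t => lagrangian lam (u t + e * phi t) (u1 t + e * phi1 t) (v1 t + e * psi1 t)) a b
    = energy lam a b (curve (fun t => u t + e * phi t) (fun t => v t + e * psi t))).
Proof.
intros Hab Hu Hv Hphi Hpsi Hrange Hpole.
generalize (varied_latitude_range a b u u1 phi phi1 Hrange Hu Hphi Hpole).
apply filter_imp; intros e He.
unfold energy; apply RInt_ext; rewrite Rmin_left, Rmax_right by lra; intros t Ht.
unfold lagrangian, dist_equator, cz at 1, curve at 1, Psi; simpl.
rewrite asin_sin by (apply He; lra).
rewrite (enorm_velocity_curve _ _ t (u1 t + e * phi1 t) (v1 t + e * psi1 t)); [reflexivity| |].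
- assert (ex_derive u t) by (eexists; apply Hu).
  assert (ex_derive phi t) by (eexists; apply Hphi).
  auto_derive; auto; rewrite (Derive_eta _ _ _ (Hu t)), (Derive_eta _ _ _ (Hphi t)); ring.
- assert (ex_derive v t) by (eexists; apply Hv).
  assert (ex_derive psi t) by (eexists; apply Hpsi).
  auto_derive; auto; rewrite (Derive_eta _ _ _ (Hv t)), (Derive_eta _ _ _ (Hpsi t)); ring.
Qed.

(** * Critical points and the defect along a fixed regular curve *)

Section Curve.
Variables (lam a b : R) (u v u1 v1 u2 v2 : R -> R).
Hypothesis hab : a < b.
Hypotheses (hu : forall t, is_derive u t (u1 t)) (hu1 : forall t, is_derive u1 t (u2 t))
  (hu2 : forall t, continuous u2 t).
Hypotheses (hv : forall t, is_derive v t (v1 t)) (hv1 : forall t, is_derive v1 t (v2 t))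
  (hv2 : forall t, continuous v2 t).
Hypothesis hemi : forall t, a <= t <= b -> 0 < u t <= PI / 2.
Hypothesis regular : forall t, a <= t <= b -> 0 < speed2 (u t) (u1 t) (v1 t).

Let speed t := sqrt (speed2 (u t) (u1 t) (v1 t)).
Let num t := curvature_num (u t) (u1 t) (v1 t) (u2 t) (v2 t).
Let defect t := catenary_defect lam (u t) (u1 t) (v1 t) (u2 t) (v2 t).

Let cu t : continuous u t.
Proof. apply (ex_derive_continuous u); eexists; apply hu. Qed.
Let cu1 t : continuous u1 t.
Proof. apply (ex_derive_continuous u1); eexists; apply hu1. Qed.
Let cv1 t : continuous v1 t.
Proof. apply (ex_derive_continuous v1); eexists; apply hv1. Qed.

Let speed_pos t : a <= t <= b -> 0 < speed t.
Proof. intros Ht; apply sqrt_lt_R0; now apply regular. Qed.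

Let continuous_speed t : continuous speed t.
Proof.
pose proof (cu t); pose proof (cu1 t); pose proof (cv1 t).
unfold speed, speed2; cont.
Qed.

Let continuous_defect t : continuous defect t.
Proof.
pose proof (cu t); pose proof (cu1 t); pose proof (cv1 t).
pose proof (hu2 t); pose proof (hv2 t).
unfold defect, catenary_defect, curvature_num, speed2; cont.
Qed.

Let pole t : a <= t <= b -> u t = PI / 2 -> u1 t <> 0 /\ (t = a \/ t = b).
Proof.
intros Ht; apply (pole_transversal a b t u u1 (v1 t)); auto.
intros s Hs; now apply hemi.
Qed.

Let cos_pos t : a < t < b -> 0 < cos (u t).
Proof.
intros Ht; destruct (hemi t) as [H1 H2]; [lra|].
apply cos_gt_0; [lra|].
destruct (Req_dec (u t) (PI / 2)) as [E|E]; [|lra].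
destruct (pole t) as [_ [H|H]]; lra.
Qed.

(** The two Euler-Lagrange expressions are $-v'$ and $u'$ times this. *)
Let weight t := cos (u t) * defect t / speed t ^ 3.

Let continuous_weight t : a <= t <= b -> continuous weight t.
Proof.
intros Ht; pose proof (cu t); pose proof (continuous_speed t); pose proof (continuous_defect t).
pose proof (pow_lt _ 3 (speed_pos t Ht)).
unfold weight; cont; lra.
Qed.

(** The differentiated integrand and the stated one differ by an exact derivative, whose primitive
    vanishes at both ends with [phi] and [psi]. *)
Lemma first_variation (phi psi : R -> R) :
  C2 phi -> C2 psi -> phi a = 0 -> phi b = 0 -> psi a = 0 -> psi b = 0 ->
  is_derive
    (fun e => energy lam a b (curve (fun t => u t + e * phi t) (fun t => v t + e * psi t)))
    0 (RInt (fun t => weight t * (v1 t * phi t - u1 t * psi t)) a b).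
Proof.
intros Hphi Hpsi Hpa Hpb Hqa Hqb.
destruct (C2_elim phi Hphi) as [phi1 [phi2 [D1 [D2 _]]]].
destruct (C2_elim psi Hpsi) as [psi1 [psi2 [E1 [E2 _]]]].
assert (cphi : forall t, continuous phi t).
{ intros t; apply (ex_derive_continuous phi); eexists; apply D1. }
assert (cphi1 : forall t, continuous phi1 t).
{ intros t; apply (ex_derive_continuous phi1); eexists; apply D2. }
assert (cpsi : forall t, continuous psi t).
{ intros t; apply (ex_derive_continuous psi); eexists; apply E1. }
assert (cpsi1 : forall t, continuous psi1 t).
{ intros t; apply (ex_derive_continuous psi1); eexists; apply E2. }
eapply is_derive_ext_loc.
{ apply (energy_varied lam a b u v u1 v1 phi psi phi1 psi1); auto.
  (* A pole can occur only at [a] or [b], where [phi] vanishes. *)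
  intros t Ht Et; destruct (pole t Ht Et) as [H0 [H|H]]; subst t; auto. }
evar_last; [now apply is_derive_RInt_lagrangian|].
set (L := fun t => lagrangian_diff lam (u t) (u1 t) (v1 t) (phi t) (phi1 t) (psi1 t)).
set (W := fun t => weight t * (v1 t * phi t - u1 t * psi t)).
assert (cW : forall t, a <= t <= b -> continuous W t).
{ intros t Ht; pose proof (continuous_weight t Ht).
  pose proof (cu1 t); pose proof (cv1 t); pose proof (cphi t); pose proof (cpsi t).
  unfold W; cont. }
assert (cL : forall t, a <= t <= b -> continuous L t).
{ intros t Ht; pose proof (continuous_speed t); pose proof (speed_pos t Ht).
  pose proof (cu t); pose proof (cu1 t); pose proof (cv1 t).
  pose proof (cphi t); pose proof (cphi1 t); pose proof (cpsi1 t).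
  unfold L, lagrangian_diff, speed2; cont; now apply Rgt_not_eq. }
assert (exL : ex_RInt L a b).
{ apply (ex_RInt_continuous (V := R_CompleteNormedModule)).
  rewrite Rmin_left, Rmax_right by lra; exact cL. }
assert (exW : ex_RInt W a b).
{ apply (ex_RInt_continuous (V := R_CompleteNormedModule)).
  rewrite Rmin_left, Rmax_right by lra; exact cW. }
assert (H : RInt (fun t => minus (L t) (W t)) a b = 0).
{ apply is_RInt_unique; evar_last.
  - apply (is_RInt_derive
      (fun s => (u s + lam) * (u1 s * phi s + v1 s * cos (u s) ^ 2 * psi s)
         / sqrt (speed2 (u s) (u1 s) (v1 s)))).
    + rewrite Rmin_left, Rmax_right by lra; intros t Ht.
      apply is_derive_boundary_term; auto.
    + rewrite Rmin_left, Rmax_right by lra; intros t Ht.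
      apply continuous_Rminus; [now apply cL | now apply cW].
  - rewrite Hpa, Hpb, Hqa, Hqb; unfold minus, plus, opp; simpl; unfold Rdiv; ring. }
rewrite (RInt_minus (V := R_CompleteNormedModule)) in H by assumption.
unfold minus, plus, opp in H; simpl in H; lra.
Qed.

(** Varying $u$ and $v$ separately kills [weight] times $v'$ and times $u'$. By regularity one of
    these derivatives is nonzero, and $\cos u>0$ inside; continuity reaches the endpoints. *)
Lemma catenary_iff_defect :
  spherical_catenary lam a b u v <-> forall t, a <= t <= b -> defect t = 0.
Proof.
assert (C0 : C2 (fun _ => 0)).
{ apply (C2_intro _ (fun _ => 0) (fun _ => 0)); intros t;
    try apply @is_derive_const; apply continuous_const. }
split; intros H.
- assert (Hvar : forall phi psi, C2 phi -> C2 psi ->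
    phi a = 0 -> phi b = 0 -> psi a = 0 -> psi b = 0 ->
    RInt (fun t => weight t * (v1 t * phi t - u1 t * psi t)) a b = 0).
  { intros phi psi H1 H2 H3 H4 H5 H6.
    rewrite <- (is_derive_unique _ _ _ (first_variation phi psi H1 H2 H3 H4 H5 H6)).
    apply is_derive_unique, H; assumption. }
  assert (Hin : forall t, a < t < b -> defect t = 0).
  { intros t Ht; assert (Ht' : a <= t <= b) by lra.
    assert (Hv : weight t * v1 t = 0).
    { apply (fundamental_lemma a b (fun s => weight s * v1 s)); [| |exact Ht].
      - intros s Hs; pose proof (cv1 s); pose proof (continuous_weight s Hs); cont.
      - intros phi HC Ha Hb.
        rewrite <- (Hvar phi (fun _ => 0) HC C0 Ha Hb eq_refl eq_refl).
        apply RInt_ext_all; intros s; ring. }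
    assert (Hu : weight t * u1 t = 0).
    { apply (fundamental_lemma a b (fun s => weight s * u1 s)); [| |exact Ht].
      - intros s Hs; pose proof (cu1 s); pose proof (continuous_weight s Hs); cont.
      - intros psi HC Ha Hb.
        (* The sign turns the integrand $-u'\psi$ into the form the fundamental lemma expects. *)
        assert (HC' : C2 (fun s => - psi s)).
        { destruct (C2_elim psi HC) as [p1 [p2 [D1 [D2 D3]]]].
          apply (C2_intro _ (fun s => - p1 s) (fun s => - p2 s)); intros s.
          - now apply (is_derive_opp psi).
          - now apply (is_derive_opp p1).
          - now apply continuous_Ropp. }
        rewrite <- (Hvar (fun _ => 0) (fun s => - psi s) C0 HC' eq_refl eq_refl).
        + apply RInt_ext_all; intros s; ring.
        + rewrite Ha; ring.
        + rewrite Hb; ring. }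
    pose proof (cos_pos t Ht) as Hc; pose proof (pow_lt _ 3 (speed_pos t Ht')) as HS.
    destruct (Req_dec (weight t) 0) as [Hw|Hw].
    - unfold weight in Hw.
      apply (Rmult_eq_reg_l (cos (u t) / speed t ^ 3)).
      + rewrite Rmult_0_r, <- Hw; field; now apply Rgt_not_eq, speed_pos.
      + apply Rgt_not_eq, Rdiv_lt_0_compat; lra.
    - exfalso; apply Rmult_integral in Hv; apply Rmult_integral in Hu.
      destruct Hv as [Hv|Hv]; [lra|]; destruct Hu as [Hu|Hu]; [lra|].
      pose proof (regular t Ht') as HQ; unfold speed2 in HQ; rewrite Hu, Hv in HQ; lra. }
  intros t Ht; apply (continuous_zero_limit a b t 1); auto; lra.
- intros phi psi H1 H2 H3 H4 H5 H6.
  evar_last; [now apply first_variation|].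
  rewrite (RInt_ext _ (fun _ => 0)).
  + rewrite RInt_const; apply (Rmult_0_r (b - a)).
  + rewrite Rmin_left, Rmax_right by lra; intros t Ht.
    assert (Ew : weight t = 0) by (unfold weight; rewrite H by lra; unfold Rdiv; ring).
    rewrite Ew; apply Rmult_0_l.
Qed.

(** * The conserved momentum and the comparison with the curvature equation *)

Let speed2_sqr t : a <= t <= b -> speed2 (u t) (u1 t) (v1 t) = speed t ^ 2.
Proof. intros Ht; symmetry; apply pow2_sqrt, Rlt_le; now apply regular. Qed.

(* The Lagrangian does not depend on [v], so the momentum conjugate to [v] is conserved. *)
Lemma momentum_constant :
  (forall t, a <= t <= b -> defect t = 0) ->
  forall s t, a <= s <= b -> a <= t <= b ->
    (u s + lam) * (v1 s * cos (u s) ^ 2) / speed s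
    = (u t + lam) * (v1 t * cos (u t) ^ 2) / speed t.
Proof.
intros H.
assert (Hd : forall t, a <= t <= b -> is_derive
  (fun s => (u s + lam) * (v1 s * cos (u s) ^ 2) / speed s) t 0).
{ intros t Ht.
  (* The momentum is the boundary term for $\varphi=0$, $\psi=1$, the rotation about the axis, along
     which the differential of the Lagrangian is zero. *)
  apply is_derive_ext with (fun s => (u s + lam) *
    (u1 s * (fun _ => 0) s + v1 s * cos (u s) ^ 2 * (fun _ => 1) s)
       / sqrt (speed2 (u s) (u1 s) (v1 s))).
  { intros s; unfold speed; cbv beta; f_equal; ring. }
  evar_last.
  - apply (is_derive_boundary_term lam t u u1 u2 v1 v2 (fun _ => 0) (fun _ => 0)
      (fun _ => 1) (fun _ => 0)); auto; apply @is_derive_const.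
  - fold (defect t); rewrite (H t Ht); unfold lagrangian_diff, Rdiv; ring. }
assert (Hle : forall s t, a <= s -> s < t -> t <= b ->
    (u s + lam) * (v1 s * cos (u s) ^ 2) / speed s
    = (u t + lam) * (v1 t * cos (u t) ^ 2) / speed t).
{ intros s t H1 H2 H3.
  apply (eq_is_derive (fun s => (u s + lam) * (v1 s * cos (u s) ^ 2) / speed s) s t);
    [|exact H2].
  intros r Hr; apply Hd; lra. }
intros s t Hs Ht; destruct (Rtotal_order s t) as [E|[E|E]].
- apply Hle; lra.
- now subst.
- symmetry; apply Hle; lra.
Qed.

(* If [u + lam] vanishes somewhere then the conserved momentum is zero, hence
   [v1 = 0] off the isolated zeros of [(u + lam) * cos u]. *)
Lemma catenary_meridian (t0 : R) :
  (forall t, a <= t <= b -> defect t = 0) -> a <= t0 <= b -> u t0 + lam = 0 ->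
  forall t, a <= t <= b -> v1 t = 0.
Proof.
intros H Ht0 E0 t Ht.
assert (Hmom : forall s, a <= s <= b -> (u s + lam) * cos (u s) * (v1 s * cos (u s)) = 0).
{ intros s Hs; pose proof (momentum_constant H s t0 Hs Ht0) as Hm.
  rewrite E0 in Hm; pose proof (speed_pos s Hs).
  apply (f_equal (fun x => x * speed s)) in Hm; unfold Rdiv in Hm.
  rewrite !Rmult_0_l in Hm; rewrite <- Hm; field; lra. }
(* Zeros cannot accumulate at [t]: a zero at [t] is simple, and a nonzero value persists by
   continuity. *)
assert (Hiso : forall f : R -> R, (forall s, a <= s <= b -> f s = 0 -> u1 s <> 0) ->
  forall l, is_derive f t l -> (f t = 0 -> u1 t <> 0 -> l <> 0) ->
  exists d, 0 < d /\ forall s, 0 < Rabs (s - t) < d -> f s <> 0).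
{ intros f Hf l Hl Hfl; destruct (Req_dec (f t) 0) as [E|E].
  - destruct (is_derive_isolated_zero f t l Hl) as [d [Hd Hn]]; [now auto|].
    rewrite E in Hn; now exists d.
  - destruct (continuous_neq0_locally f t) as [d [Hd Hn]]; auto.
    + apply (ex_derive_continuous f); now exists l.
    + exists d; split; [exact Hd|]; intros s Hs; apply Hn; lra. }
assert (ex_derive u t) by (eexists; apply hu).
destruct (Hiso (fun s => u s + lam)) with (l := u1 t) as [d1 [Hd1 N1]].
(* Where $u+\lambda=0$, the vanishing defect reads $v'\cos u\,|\gamma'|^2=0$, so regularity leaves
   $u'\neq0$. *)
{ intros s Hs E E1; pose proof (H s Hs) as HD; pose proof (regular s Hs) as HQ.
  unfold defect, catenary_defect in HD; rewrite E, Rmult_0_l, Rminus_0_r in HD.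
  apply Rmult_integral in HD; destruct HD as [HD|HD]; [|lra].
  unfold speed2 in HQ; rewrite E1, HD in HQ; lra. }
{ auto_derive; auto; rewrite (Derive_eta _ _ _ (hu t)); ring. }
{ auto. }
assert (Hcos : forall s, a <= s <= b -> cos (u s) = 0 -> u1 s <> 0).
{ intros s Hs E E1; pose proof (regular s Hs) as HQ.
  unfold speed2 in HQ; rewrite E1, E in HQ; lra. }
destruct (Hiso (fun s => cos (u s)) Hcos) with (l := - sin (u t) * u1 t) as [d2 [Hd2 N2]].
{ auto_derive; auto; rewrite (Derive_eta _ _ _ (hu t)); ring. }
{ intros Hc Hu E; apply Rmult_integral in E; destruct E as [E|E]; [|contradiction].
  pose proof (cos2 (u t)) as E2; unfold Rsqr in E2; nra. }
(* Close to [t], but off it, both factors are nonzero, so the zero momentum gives $v'=0$ there and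
   in the limit at [t]. *)
apply (continuous_zero_limit a b t (Rmin d1 d2)); auto; [now apply Rmin_pos|].
intros s Hs Hd; pose proof (Rmin_l d1 d2); pose proof (Rmin_r d1 d2).
assert (Hs' : a <= s <= b) by lra.
pose proof (Hmom s Hs') as E; specialize (N1 s ltac:(lra)); specialize (N2 s ltac:(lra)).
cbv beta in N1, N2.
apply Rmult_integral in E; destruct E as [E|E]; apply Rmult_integral in E; tauto.
Qed.

(** Where $u+\lambda\neq0$ the two sides differ by $-D/((u+\lambda)|\gamma'|^3)$, with $D$ the
    defect. Where $u+\lambda=0$ the quotient is $0$ by convention, and each direction has its own
    argument. *)
Lemma defect_iff_curvature :
  (forall t, a <= t <= b -> defect t = 0) <->
  (forall t, a <= t <= b ->
     num t / speed t ^ 3 = v1 t * cos (u t) / speed t / (u t + lam)).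
Proof.
assert (Hgen : forall t, a <= t <= b -> u t + lam <> 0 ->
  (defect t = 0 <-> num t / speed t ^ 3 = v1 t * cos (u t) / speed t / (u t + lam))).
{ intros t Ht Hne; pose proof (speed_pos t Ht) as HS.
  assert (E : num t / speed t ^ 3 - v1 t * cos (u t) / speed t / (u t + lam)
    = - defect t / ((u t + lam) * speed t ^ 3)).
  { unfold defect, catenary_defect; fold (num t); rewrite (speed2_sqr t Ht).
    field; split; lra. }
  split; intros H.
  - rewrite H in E; apply Rminus_diag_uniq; rewrite E; unfold Rdiv; ring.
  - rewrite H, Rminus_diag in E.
    assert (0 < speed t ^ 3) by now apply pow_lt.
    apply (Rmult_eq_reg_l (- / ((u t + lam) * speed t ^ 3))).
    + rewrite Rmult_0_r, E at 1; unfold Rdiv; ring.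
    + apply Ropp_neq_0_compat, Rinv_neq_0_compat, Rmult_integral_contrapositive; split; lra. }
split; intros H t Ht.
- destruct (Req_dec (u t + lam) 0) as [E|E]; [|now apply Hgen; auto].
  (* On a meridian $v'=v''=0$, so both sides vanish. *)
  pose proof (catenary_meridian t H Ht E) as Hv.
  assert (Hv2 : v2 t = 0) by (apply (is_derive_constant_on a b t _ 0 v1); auto).
  unfold num, curvature_num; rewrite Hv2, (Hv t Ht); unfold Rdiv; ring.
- destruct (Req_dec (u t + lam) 0) as [E|E]; [|now apply Hgen; auto].
  destruct (Req_dec (defect t) 0) as [Ed|Ed]; [exact Ed|exfalso].
  (* Otherwise [u] is constant near [t]; but no parallel off the equator is a geodesic. *)
  destruct (continuous_neq0_locally defect t (continuous_defect t) Ed) as [d [Hd Hn]].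
  (* A nondegenerate segment containing [t], inside both $[a,b]$ and the ball; [t] may be one of its
     ends. *)
  set (p := Rmax a (t - d / 2)); set (q := Rmin b (t + d / 2)).
  assert (Hpq : a <= p /\ q <= b /\ p < q /\ p <= t <= q /\ t - d < p /\ q < t + d).
  { unfold p, q, Rmax, Rmin; destruct (Rle_dec a _), (Rle_dec b _); lra. }
  destruct Hpq as [Hp [Hq [Hlt [Htpq [Hpd Hqd]]]]].
  (* Where $u+\lambda\neq0$, [Hgen] would make the defect vanish. *)
  assert (Hu0 : forall s, p <= s <= q -> u s = - lam).
  { intros s Hs; destruct (Req_dec (u s + lam) 0) as [Es|Es]; [lra|exfalso].
    apply (Hn s); [apply Rabs_def1; lra|]; apply Hgen; [lra | exact Es | apply H; lra]. }
  assert (Hu1 : forall s, p <= s <= q -> u1 s = 0).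
  { intros s Hs; now apply (is_derive_constant_on p q s _ (- lam) u). }
  assert (Hu2 : u2 t = 0) by now apply (is_derive_constant_on p q t _ 0 u1).
  pose proof (H t Ht) as HK; rewrite E in HK.
  (* Division by zero returns $0$, so the equation says $\kappa_s=0$. *)
  replace (v1 t * cos (u t) / speed t / 0) with 0 in HK
    by (unfold Rdiv; rewrite Rinv_0; ring).
  pose proof (speed_pos t Ht) as HS; pose proof (pow_lt _ 3 HS) as HS3.
  assert (HK0 : num t = 0).
  { replace (num t) with (num t / speed t ^ 3 * speed t ^ 3) by (field; lra).
    rewrite HK; ring. }
  pose proof (regular t Ht) as HQ.
  unfold num, curvature_num in HK0; unfold speed2 in HQ.
  rewrite (Hu1 t Htpq) in HK0, HQ; rewrite Hu2 in HK0.
  assert (Hw : v1 t * cos (u t) <> 0).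
  { intros Ew; rewrite Ew in HQ; lra. }
  assert (Hs : 0 < sin (u t)).
  { pose proof (hemi t Ht); pose proof PI_RGT_0; apply sin_gt_0; lra. }
  assert (Hv : v1 t <> 0) by (intros Ev; apply Hw; rewrite Ev; ring).
  (* With $u'=u''=0$ the numerator is $v'^3\sin u\cos^2u$, and no factor of it vanishes. *)
  assert (HK1 : (v1 t * cos (u t)) ^ 2 * (v1 t * sin (u t)) = 0) by (rewrite <- HK0; ring).
  apply Rmult_integral in HK1; destruct HK1 as [HK1|HK1].
  + now apply (pow_nonzero _ 2) in Hw.
  + apply Rmult_integral in HK1; destruct HK1; lra.
Qed.

End Curve.

(** * Return from the chart to the curve on the sphere *)

Theorem theorem2p5 (lam a b : R) (u v : R -> R)
  (hab : a < b)
  (hu : C2 u) (hv : C2 v)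
  (hemi : forall t : R, a <= t <= b -> 0 < u t <= PI / 2)
  (regular : forall t : R, a <= t <= b -> velocity (curve u v) t <> (0, 0, 0)) :
  spherical_catenary lam a b u v <->
  (forall t : R, a <= t <= b ->
     geodesic_curvature (curve u v) t =
     dot (unit_normal (curve u v) t) (Xfield (u t) (v t))
       / (dist_equator (curve u v t) + lam)).
Proof.
destruct (C2_elim u hu) as [u1 [u2 [Hu [Hu1 Hu2]]]].
destruct (C2_elim v hv) as [v1 [v2 [Hv [Hv1 Hv2]]]].
assert (HQ : forall t, a <= t <= b -> 0 < speed2 (u t) (u1 t) (v1 t)).
{ intros t Ht; apply (speed2_pos u v t); auto. }
rewrite (catenary_iff_defect lam a b u v u1 v1 u2 v2) by assumption.
rewrite (defect_iff_curvature lam a b u u1 v1 u2 v2) by assumption.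
(* On $[a,b]$ the latitude lies in the range of [asin], so it equals the distance. *)
assert (E : forall t, a <= t <= b -> dist_equator (curve u v t) = u t).
{ intros t Ht; pose proof (hemi t Ht); pose proof PI_RGT_0.
  apply (asin_sin (u t)); lra. }
split; intros H t Ht; specialize (H t Ht).
- rewrite (geodesic_curvature_curve u v u1 v1 u2 v2) by assumption.
  now rewrite (dot_unit_normal_Xfield u v t (u1 t) (v1 t)), E.
- rewrite (geodesic_curvature_curve u v u1 v1 u2 v2) in H by assumption.
  now rewrite (dot_unit_normal_Xfield u v t (u1 t) (v1 t)), E in H.
Qed.
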